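(* Let $\ell_1,\ldots,\ell_r$ ($r\ge n$) be general linear forms in $S=\Bbbk[x_1,\ldots,x_n]$, let $d_1,\ldots,d_r$ be positive integers, let $d$ be a non-negative integer, and let $k=d_1+\cdots+d_n-n-2d$. If $d_j+k\le 0$ for some $n+1\le j\le r$ or $d+k<0$, then \[\dim_\Bbbk\left(S/(\ell_1^{d_1},\ldots,\ell_r^{d_r})\right)_d=0.\] Otherwise \[\dim_\Bbbk\left(S/(\ell_1^{d_1},\ldots,\ell_r^{d_r})\right)_d=\dim_\Bbbk\left(S/(\ell_1^{d_1'},\ldots,\ell_r^{d_r'})\right)_{d+k},\] where \[d_i'=\begin{cases}d_i&\text{if }1\le i\le n,\\ d_i+k&\text{if }n+1\le i\le r.\end{cases}\]
   Context: $\Bbbk$ is a field of characteristic zero and $S$ has the standard grading. ''General linear forms'' means that the statement holds for all $(\ell_1,\ldots,\ell_r)$ in some nonempty Zariski open subset of $(S_1)^r$. *)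

(* Defs.v *)
From HB Require Import structures.
From mathcomp Require Import all_boot all_order all_algebra.
From mathcomp Require Import generic_quotient ring_quotient.
From mathcomp Require Export mpoly.
From Stdlib Require Import Classical ClassicalEpsilon.

Set Implicit Arguments.
Unset Strict Implicit.
Unset Printing Implicit Defensive.

Import GRing.Theory.
Local Open Scope ring_scope.
Local Open Scope quotient_scope.

Section QuotientSpace.
Variables (K : fieldType) (V : vectType K) (U : {vspace V}).

Definition quotvs := {ideal_quot pred_of_vspace U}.
HB.instance Definition _ := GRing.Zmodule.on quotvs.
HB.instance Definition _ := EqQuotient.on quotvs.

Definition quotvs_pi (v : V) : quotvs := \pi_quotvs v.

Lemma quotvs_eq (u v : V) : quotvs_pi u = quotvs_pi v <-> u - v \in U.
Proof.
rewrite /quotvs_pi; split=> [/eqP|uv]; first by rewrite -Quotient.idealrBE.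
by apply/eqP; rewrite -Quotient.idealrBE.
Qed.

Lemma quotvs_piK (q : quotvs) : quotvs_pi (repr q) = q.
Proof. exact: reprK. Qed.

Lemma quotvs_piD u v : quotvs_pi (u + v) = quotvs_pi u + quotvs_pi v.
Proof. by rewrite /quotvs_pi !piE. Qed.

Definition quotvs_scale (a : K) (q : quotvs) : quotvs := quotvs_pi (a *: repr q).

Lemma quotvs_scale_pi a v : quotvs_scale a (quotvs_pi v) = quotvs_pi (a *: v).
Proof.
apply/quotvs_eq; rewrite -scalerBr memvZ //.
by apply/quotvs_eq; rewrite quotvs_piK.
Qed.

Lemma quotvs_scaleA a b q :
  quotvs_scale a (quotvs_scale b q) = quotvs_scale (a * b) q.
Proof. by rewrite -[q]quotvs_piK !quotvs_scale_pi scalerA. Qed.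

Lemma quotvs_scale1 : left_id 1 quotvs_scale.
Proof. by move=> q; rewrite -[q]quotvs_piK quotvs_scale_pi scale1r. Qed.

Lemma quotvs_scaleDr : right_distributive quotvs_scale +%R.
Proof.
move=> a p q; rewrite -[p]quotvs_piK -[q]quotvs_piK -quotvs_piD !quotvs_scale_pi.
by rewrite scalerDr quotvs_piD.
Qed.

Lemma quotvs_scaleDl q : {morph quotvs_scale^~ q : a b / a + b}.
Proof.
move=> a b; rewrite -[q]quotvs_piK !quotvs_scale_pi.
by rewrite scalerDl quotvs_piD.
Qed.

HB.instance Definition _ := GRing.Zmodule_isLmodule.Build K quotvs
  quotvs_scaleA quotvs_scale1 quotvs_scaleDr quotvs_scaleDl.

Lemma quotvs_pi_is_linear : linear quotvs_pi.
Proof. by move=> a u v; rewrite quotvs_piD -quotvs_scale_pi. Qed.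
HB.instance Definition _ :=
  GRing.isLinear.Build K V quotvs _ quotvs_pi quotvs_pi_is_linear.

Lemma quotvs_vecaxiom : Vector.axiom (\dim {:V} - \dim U)%N quotvs.
Proof.
rewrite -dimv_compl; set W := (U^C)%VS.
pose c (v : V) := v - projv U v.
have cW v : c v \in W by apply: memv_projC.
have cB u v : c (u - v) = c u - c v.
  by rewrite /c linearB /= !opprD addrACA.
have cZ a v : c (a *: v) = a *: c v by rewrite /c linearZ /= scalerBr.
have cU u : u \in U -> c u = 0 by move=> uU; rewrite /c projv_id // subrr.
have pic v : quotvs_pi (c v) = quotvs_pi v.
  by apply/quotvs_eq; rewrite /c addrAC subrr add0r memvN memv_proj.
have crepr v : c (repr (quotvs_pi v)) = c v.
  apply/eqP; rewrite -subr_eq0 -cB; apply/eqP/cU.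
  by apply/quotvs_eq; rewrite quotvs_piK.
have cWid w : w \in W -> c w = w.
  by rewrite /W -lker_proj memv_ker /c => /eqP ->; rewrite subr0.
pose b := vbasis W.
pose f (q : quotvs) : 'rV[K]_(\dim W) := \row_i coord b i (c (repr q)).
pose g (x : 'rV[K]_(\dim W)) : quotvs := quotvs_pi (\sum_i x 0 i *: b`_i).
have fpi v : f (quotvs_pi v) = \row_i coord b i (c v) by rewrite /f crepr.
exists f.
  move=> a p q; rewrite -[p]quotvs_piK -[q]quotvs_piK -linearP !fpi.
  apply/rowP=> i; rewrite !mxE.
  have -> u v : c (a *: u + v) = a *: c u + c v.
    by rewrite /c linearP /= scalerBr opprD addrACA.
  by rewrite linearP.
exists g => [q|x]; rewrite /g.
  rewrite -[RHS]quotvs_piK -(pic (repr q)); congr quotvs_pi.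
  rewrite [RHS](coord_vbasis (cW (repr q))).
  by apply: eq_bigr => i _; rewrite mxE.
rewrite fpi cWid; last first.
  by apply: memv_suml => i _; rewrite memvZ // vbasis_mem // memt_nth.
by apply/rowP=> i; rewrite mxE coord_sum_free // (basis_free (vbasisP W)).
Qed.

HB.instance Definition _ := Lmodule_hasFinDim.Build K quotvs quotvs_vecaxiom.

Lemma dim_quotvs : \dim {:quotvs} = (\dim {:V} - \dim U)%N.
Proof. by rewrite dimvf. Qed.

End QuotientSpace.

Lemma vspace_of_prop (K : fieldType) (V : vectType K) (P : V -> Prop) :
    P 0 -> (forall a u v, P u -> P v -> P (a *: u + v)) ->
  exists U : {vspace V}, forall v, v \in U <-> P v.
Proof.
move=> P0 PL.
have [] // := NNPP (exists U : {vspace V}, (forall v, v \in U -> P v) /\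
  forall W : {vspace V}, (forall v, v \in W -> P v) -> (\dim W <= \dim U)%N).
  move=> noU; suff big m : exists U : {vspace V},
      (forall v, v \in U -> P v) /\ (m <= \dim U)%N.
    by have [U [_]] := big (\dim {:V}).+1; rewrite ltnNge dimvS ?subvf.
  elim: m => [|m [U [UP mU]]].
    by exists 0%VS; split=> // v; rewrite memv0 => /eqP ->.
  apply: NNPP => noW; apply: noU; exists U; split=> // W WP.
  rewrite (leq_trans _ mU) // leqNgt; apply/negP => mW.
  by apply: noW; exists W.
move=> U [UP Umax]; exists U => v; split=> [|Pv]; first exact: UP.
have /Umax dimle : forall w, w \in (<[v]> + U)%VS -> P w.
  by move=> w /memv_addP[_ /vlineP[a ->] [u uU ->]]; apply: PL => //; apply: UP.
have : (U == <[v]> + U)%VS by rewrite eqEdim addvSr dimle.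
by move/eqP->; apply: (subvP (addvSl _ _)); exact: memv_line.
Qed.

Definition in_ideal (A : comNzRingType) r (g : 'I_r -> A) (f : A) : Prop :=
  exists c : 'I_r -> A, f = \sum_i c i * g i.

Section GradedPieces.
Variables (K : fieldType) (n r : nat).

Lemma ideal_piece_ex (g : 'I_r -> {mpoly K[n.+1]}) (d : nat) :
  exists U : {vspace dhomog n.+1 K d},
    forall f, f \in U <-> in_ideal g (mpoly_of_dhomog f).
Proof.
apply: vspace_of_prop => [|a u v [cu eu] [cv ev]].
  by exists (fun=> 0); rewrite linear0 big1 // => i _; rewrite mul0r.
exists (fun i => a *: cu i + cv i); rewrite linearP /= eu ev scaler_sumr -big_split.
by apply: eq_bigr => i _; rewrite mulrDl scalerAl.
Qed.

(* The elements of degree d of the ideal generated by g; the coefficients in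
   in_ideal are arbitrary polynomials, and g need not be homogeneous. *)
Definition ideal_piece (g : 'I_r -> {mpoly K[n.+1]}) (d : nat) :
    {vspace dhomog n.+1 K d} :=
  sval (constructive_indefinite_description _ (ideal_piece_ex g d)).

Lemma mem_ideal_piece g d (f : dhomog n.+1 K d) :
  f \in ideal_piece g d <-> in_ideal g (mpoly_of_dhomog f).
Proof.
by rewrite /ideal_piece; case: constructive_indefinite_description.
Qed.

(* For g homogeneous the grading of S/(g) is (S/(g))_d = S_d / (S_d :&: (g)). *)
Definition dim_quot_piece (g : 'I_r -> {mpoly K[n.+1]}) (d : nat) : nat :=
  \dim {:quotvs (ideal_piece g d)}.

Definition zariski_open m (U : 'rV[K]_m -> Prop) : Prop :=
  exists F : {mpoly K[m]} -> Prop,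
    forall x, U x <-> exists2 f, F f & f.@[fun i => x 0 i] != 0.

(* (S_1)^r is identified with affine space through the coefficients of
   the variables. *)
Definition coef_forms (l : 'I_r -> dhomog n.+1 K 1) : 'rV[K]_(r * n.+1) :=
  mxvec (\matrix_(i < r, j < n.+1) (mpoly_of_dhomog (l i))@_(U_(j))).

Definition for_general_forms (P : ('I_r -> dhomog n.+1 K 1) -> Prop) : Prop :=
  exists U : 'rV[K]_(r * n.+1) -> Prop,
    [/\ zariski_open U, (exists x, U x) & forall l, U (coef_forms l) -> P l].

End GradedPieces.

Definition power_forms (K : fieldType) (n r : nat)
    (l : 'I_r -> dhomog n.+1 K 1) (e : 'I_r -> nat) :
    'I_r -> {mpoly K[n.+1]} :=
  fun i => mpoly_of_dhomog (l i) ^+ e i.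

(* Main.v *)
(** Let N = n+1 and let the linear form l_j have coefficient vector p_j.  Under
    the apolarity pairing the annihilator of the degree d piece of the ideal
    (l_j^(e_j)) consists of the forms f of degree d killed by the e_j-th power
    of the derivative along p_j, for every j; equivalently, f(y + t p_j) has
    degree less than e_j in t.  If the first N forms are the variables, the first
    N conditions say that every monomial of f divides x^delta, where
    delta_i = d_i - 1.  The Cremona map x^m |-> x^(delta - m) is then an
    isomorphism onto forms of degree |delta| - d = d + k with exponents bounded by
    delta.  Writing it as f |-> x^delta f(1/x), the degree in t along a line in
    direction 1/p_j is controlled by the degree of f along p_j, which turns the
    exponent d_j into d_j + k.

    Dimensions are upper semicontinuous in the coefficients of the forms, and a
    general family becomes normalized (first N forms the variables, all other
    coefficients nonzero) after a linear change of coordinates.  Since the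
    correspondence (d_j, d) <-> (d_j', d + k) is symmetric, it suffices to compare
    the minimal dimensions, and no genericity has to be transported through
    p |-> 1/p. *)

From HB Require Import structures.
Require Import Defs.
From Stdlib Require Import Classical.
From mathcomp Require Import all_boot all_order all_algebra zify ssrcomplements.

Set Implicit Arguments.
Unset Strict Implicit.
Unset Printing Implicit Defensive.

Import Order.TTheory GRing.Theory Num.Theory.
Local Open Scope ring_scope.

(** * Directional derivatives and Taylor expansion *)

Lemma mpoly_gen_ind (R : nzRingType) (n : nat) (P : {mpoly R[n]} -> Prop) :
    (forall c, P c%:MP) -> (forall i, P 'X_i) ->
    (forall f g, P f -> P g -> P (f + g)) ->
    (forall f g, P f -> P g -> P (f * g)) ->
  forall f, P f.
Proof.
move=> PC PX PD PM f; rewrite [f]mpolyE.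
apply: (big_ind P) => [|//|m _]; first by rewrite -mpolyC0.
rewrite -mul_mpolyC; apply: (PM) => //; rewrite mpolyXE_id.
apply: (big_ind P) => [|//|i _]; first by rewrite -mpolyC1.
by elim: (m i) => [|k IHk]; rewrite ?expr0 -?mpolyC1 // exprS; apply: PM.
Qed.

Lemma mpoly_morph_ext (R S : nzRingType) (n : nat)
    (a b : {rmorphism {mpoly R[n]} -> S}) :
    (forall c, a c%:MP = b c%:MP) -> (forall i, a 'X_i = b 'X_i) -> a =1 b.
Proof.
move=> eqC eqX; apply: mpoly_gen_ind => // f g ef eg.
  by rewrite !rmorphD /= ef eg.
by rewrite !rmorphM /= ef eg.
Qed.

Lemma char0_mulrn_eq0 (K : fieldType) (V : lmodType K) (v : V) (k : nat) :
  [pchar K] =i pred0 -> (0 < k)%N -> v *+ k = 0 -> v = 0.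
Proof.
move=> /pcharf0P char0 k_gt0 /eqP; rewrite -scaler_nat scaler_eq0 char0.
by case/orP => [/eqP k0|/eqP //]; rewrite k0 in k_gt0.
Qed.

Section DirectionalDerivative.
Variables (K : fieldType) (n : nat) (p : 'I_n -> K).
Implicit Types f g : {mpoly K[n]}.

Definition dird f : {mpoly K[n]} := \sum_i p i *: f^`M(i).

Lemma dird_is_linear : linear dird.
Proof.
move=> a f g; rewrite /dird scaler_sumr -big_split; apply: eq_bigr => i _ /=.
by rewrite linearP scalerDr !scalerA mulrC.
Qed.
HB.instance Definition _ :=
  GRing.isLinear.Build K {mpoly K[n]} {mpoly K[n]} _ dird dird_is_linear.

Lemma dirdD f g : dird (f + g) = dird f + dird g.
Proof. exact: linearD. Qed.

Lemma dirdM f g : dird (f * g) = dird f * g + f * dird g.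
Proof.
rewrite /dird mulr_suml mulr_sumr -big_split; apply: eq_bigr => i _ /=.
by rewrite mderivM scalerDr scalerAl scalerAr.
Qed.

Lemma dirdX i : dird 'X_i = (p i)%:MP.
Proof.
rewrite /dird (bigD1 i) //= big1 ?addr0 => [|j ji]; rewrite mderivX mnm1E.
  have -> : (U_(i) - U_(i) = 0 :> 'X_{1..n})%MM.
    by apply/mnmP => j; rewrite mnmBE subnn mnm0E.
  by rewrite eqxx scale1r mpolyX0 -mpolyC1 -mul_mpolyC mpolyC1 mulr1.
by rewrite eq_sym (negPf ji) scale0r scaler0.
Qed.

Lemma dirdC c : dird c%:MP = 0.
Proof. by rewrite /dird big1 // => i _; rewrite mderivC scaler0. Qed.

Lemma dird_homog d f : f \is d.+1.-homog -> dird f \is d.-homog.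
Proof.
move=> fh; rewrite rpred_sum // => i _; rewrite rpredZ //.
apply/dhomogP => m; rewrite mcoeff_msupp mcoeff_mderiv => nz.
have : (m + U_(i))%MM \in msupp f.
  by rewrite mcoeff_msupp; apply: contraNneq nz => ->; rewrite mul0rn.
by move/(dhomog_mf fh) => /=; rewrite mdegD mdeg1 addn1 => -[].
Qed.

Lemma dird_homog0 f : f \is 0.-homog -> dird f = 0.
Proof.
move=> fh; suff -> : f = (f@_0%MM)%:MP by rewrite dirdC.
apply/mpolyP => m; rewrite mcoeffC.
have [->|m0] := eqVneq m 0%MM; rewrite ?mulr1 // mulr0.
by apply: (dhomog_nemf_coeff fh); rewrite mdeg_eq0.
Qed.

Lemma iter_dird_homog d k f : f \is d.-homog ->
  iter k dird f \is (d - k).-homog.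
Proof.
move=> fh; elim: k => [|k IHk] /=; first by rewrite subn0.
(* Subtraction is truncated: past degree 0 every derivative vanishes, and 0 is homogeneous of every
   degree. *)
rewrite subnS; case: (d - k)%N IHk => [/dird_homog0 ->|j /dird_homog //].
exact: rpred0.
Qed.

(* [f(y + t p)] as a polynomial in t; locked because unification would otherwise
   unfold the substitution when comparing two instances. *)
Fact taylor_key : unit. Proof. by []. Qed.
Definition taylor : {mpoly K[n]} -> {poly {mpoly K[n]}} :=
  locked_with taylor_key
    (mmap (@polyC {mpoly K[n]} \o @mpolyC n K)
          (fun i => ('X_i)%:P + ((p i)%:MP)%:P * 'X)).

Lemma taylorE f : taylor f =
  mmap (@polyC {mpoly K[n]} \o @mpolyC n K)
       (fun i => ('X_i)%:P + ((p i)%:MP)%:P * 'X) f.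
Proof. by rewrite [taylor]unlock. Qed.

Lemma taylorC c : taylor c%:MP = (c%:MP)%:P.
Proof. by rewrite taylorE mmapC. Qed.

Lemma taylorX i : taylor 'X_i = ('X_i)%:P + ((p i)%:MP)%:P * 'X.
Proof. by rewrite taylorE mmapX mmap1U. Qed.

Lemma taylorD f g : taylor (f + g) = taylor f + taylor g.
Proof. by rewrite !taylorE mmapD. Qed.

Lemma taylorM f g : taylor (f * g) = taylor f * taylor g.
Proof. by rewrite !taylorE rmorphM. Qed.

(** The chain rule. Both sides are additive and obey the Leibniz rule over [taylor], so constants
    and variables suffice. *)
Lemma deriv_taylor f : (taylor f)^`() = taylor (dird f).
Proof.
elim/mpoly_gen_ind: f => [c|i|f g ef eg|f g ef eg].
- by rewrite dirdC taylorC derivC -mpolyC0 taylorC mpolyC0.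
- rewrite dirdX taylorX taylorC derivD derivM !derivC derivX add0r mul0r add0r.
  by rewrite mulr1.
- by rewrite dirdD !taylorD derivD ef eg.
- by rewrite dirdM taylorM derivM ef eg taylorD !taylorM.
Qed.

Lemma horner0_taylor f : (taylor f).[0] = f.
Proof.
elim/mpoly_gen_ind: f => [c|i|f g ef eg|f g ef eg].
- by rewrite taylorC hornerC.
- by rewrite taylorX !hornerE.
- by rewrite taylorD hornerD ef eg.
- by rewrite taylorM hornerM ef eg.
Qed.

Lemma taylor_neq0 f : f != 0 -> taylor f != 0.
Proof. by apply: contra_neq => f0; rewrite -(horner0_taylor f) f0 horner0. Qed.

(** Taylor's formula, from iterating [deriv_taylor] and setting t = 0; the factorial stays on the
    left to avoid division. *)
Lemma coef_taylor f k : (taylor f)`_k *+ k`! = iter k dird f.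
Proof.
have <- : ((taylor f)^`(k)).[0] = iter k dird f.
  rewrite -[RHS]horner0_taylor; congr (_.[0]).
  elim: k => [|k IHk]; first by rewrite derivn0.
  by rewrite derivnS IHk deriv_taylor.
by rewrite horner_coef0 coef_derivn addn0 ffactnn.
Qed.

Hypothesis char0 : [pchar K] =i pred0.

(** Since [size] is the degree plus one, being killed by the e-th derivative along p amounts to
    degree less than e in t; characteristic zero allows division by k!. *)
Lemma size_taylorP e f : reflect (iter e dird f = 0) (size (taylor f) <= e)%N.
Proof.
apply: (iffP idP) => [le_e|de0].
  by rewrite -coef_taylor nth_default // mul0rn.
apply/leq_sizeP => k le_ek; apply: (char0_mulrn_eq0 char0 (fact_gt0 k)).
rewrite coef_taylor -(subnK le_ek) iterD de0.
by elim: (k - e)%N => //= j ->; rewrite linear0.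
Qed.

Lemma size_taylor_homog d f : f \is d.-homog -> (size (taylor f) <= d.+1)%N.
Proof.
move=> fh; apply/size_taylorP => /=; apply: dird_homog0.
by have := iter_dird_homog d fh; rewrite subnn.
Qed.

Lemma coef_taylor_homog d k f : f \is d.-homog ->
  (taylor f)`_k \is (d - k).-homog.
Proof.
move=> /(iter_dird_homog k); rewrite -coef_taylor => h.
suff -> : (taylor f)`_k = (k`!%:R)^-1 *: ((taylor f)`_k *+ k`!) by rewrite rpredZ.
rewrite -scaler_nat scalerA mulVf ?scale1r //.
by move/pcharf0P: char0 => ->; rewrite -lt0n fact_gt0.
Qed.

End DirectionalDerivative.

(** The increment t may be any ring element; [size_taylor_crem] uses a product of linear
    polynomials. *)
Lemma mmap_taylor (K : fieldType) (n : nat) (S : comNzRingType)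
    (a : {rmorphism K -> S}) (p : 'I_n -> K) (h : 'I_n -> S) (t : S)
    (f : {mpoly K[n]}) :
  mmap a (fun i => h i + a (p i) * t) f =
  \sum_(k < size (taylor p f)) mmap a h (taylor p f)`_k * t ^+ k.
Proof.
transitivity (map_poly (mmap a h) (taylor p f)).[t]; last first.
  rewrite (horner_coef_wide _ (size_poly _ _)).
  by apply: eq_bigr => k _; rewrite coef_map.
elim/mpoly_gen_ind: f => [c|i|f g ef eg|f g ef eg].
- by rewrite taylorC map_polyC hornerC /= !mmapC.
- rewrite taylorX rmorphD rmorphM /= !map_polyC map_polyX !hornerE /=.
  by rewrite mmapC !mmapX !mmap1U.
- by rewrite taylorD mmapD rmorphD hornerD ef eg.
- rewrite taylorM (rmorphM (mmap a _)) (rmorphM (map_poly (mmap a h))) hornerM.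
  by rewrite /= ef eg.
Qed.

(** * Degree bounds for univariate polynomials *)

Section DegreeBounds.
Variable R : comNzRingType.
Implicit Types u v : {poly R}.

(** A bound [size u <= a.+1] says that the degree is at most a, zero polynomial included; in this
    form bounds add under products. *)
Lemma size_mul_le u v a b :
  (size u <= a.+1)%N -> (size v <= b.+1)%N -> (size (u * v)%R <= (a + b).+1)%N.
Proof.
move=> ua vb; apply: leq_trans (size_polyMleq _ _) _.
by rewrite -subn1 leq_subLR add1n -addSn -addnS leq_add.
Qed.

Lemma size_prod_le (I : finType) (P : pred I) (F : I -> {poly R}) (b : I -> nat) :
    (forall i, P i -> (size (F i) <= (b i).+1)%N) ->
  (size (\prod_(i | P i) F i)%R <= (\sum_(i | P i) b i).+1)%N.
Proof.
move=> bF; apply: (big_rec2 (fun u k => size u <= k.+1)%N) => [|i k u Pi uk].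
  by rewrite size_poly1.
by apply: size_mul_le => //; apply: bF.
Qed.

Lemma size_exp_bound u a k : (size u <= a.+1)%N -> (size (u ^+ k) <= (a * k).+1)%N.
Proof.
move=> ua; elim: k => [|k IHk]; first by rewrite expr0 muln0 size_poly1.
by rewrite exprS mulnS; apply: size_mul_le.
Qed.

Lemma size_mmap_homog (K : nzRingType) (n d b : nat) (a : K -> R)
    (w : 'I_n -> {poly R}) (f : {mpoly K[n]}) :
    f \is d.-homog -> (forall i, (size (w i) <= b.+1)%N) ->
  (size (mmap (@polyC R \o a) w f) <= (b * d).+1)%N.
Proof.
move=> /dhomog_mf fh wb; rewrite /mmap big_seq.
apply: (big_ind (fun u => size u <= (b * d).+1)%N) => [|u v ub vb|m /fh /= <-].
- by rewrite size_poly0.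
- by apply: leq_trans (size_polyD _ _) _; rewrite geq_max ub.
apply: (@size_mul_le _ _ 0); first exact: size_polyC_leq1.
by rewrite multE mdegE big_distrr; apply: size_prod_le => i _; apply: size_exp_bound.
Qed.

End DegreeBounds.

(** * The Cremona map *)

Section Cremona.
Variables (K : fieldType) (n : nat) (delta : 'X_{1..n}).
Implicit Types f g : {mpoly K[n]}.

(* [x^delta f(1/x)], with the monomials of f not dividing x^delta discarded. *)
Definition crem f : {mpoly K[n]} :=
  \sum_(m : 'X_{1..n < (mdeg delta).+1} | (m <= delta)%MM)
     f@_m *: 'X_[delta - m].

Lemma crem_is_linear : linear crem.
Proof.
move=> a f g; rewrite /crem scaler_sumr -big_split; apply: eq_bigr => m _ /=.
by rewrite mcoeffD mcoeffZ scalerDl scalerA.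
Qed.
HB.instance Definition _ :=
  GRing.isLinear.Build K {mpoly K[n]} {mpoly K[n]} _ crem crem_is_linear.

Lemma lepm_mdeg (m1 m2 : 'X_{1..n}) : (m1 <= m2)%MM -> (mdeg m1 <= mdeg m2)%N.
Proof. by move=> /submK <-; rewrite mdegD leq_addl. Qed.

Lemma subKm (m : 'X_{1..n}) : (m <= delta)%MM -> (delta - (delta - m) = m)%MM.
Proof.
by move=> /mnm_lepP le_m; apply/mnmP => i; rewrite !mnmBE subKn.
Qed.

Lemma mdeg_subm (m : 'X_{1..n}) : (m <= delta)%MM ->
  mdeg (delta - m) = (mdeg delta - mdeg m)%N.
Proof. by move=> le_m; rewrite -{2}(submK le_m) mdegD addnK. Qed.

Lemma mcoeff_crem f m :
  (crem f)@_m = if (m <= delta)%MM then f@_(delta - m) else 0.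
Proof.
rewrite /crem raddf_sum /=.
case: ifPn => [le_m|nle_m]; last first.
  rewrite big1 // => k le_k; rewrite mcoeffZ mcoeffX.
  case: eqP nle_m => [<-|]; last by rewrite mulr0.
  by rewrite lem_subr.
have lt_m : (mdeg (delta - m) < (mdeg delta).+1)%N.
  by rewrite ltnS lepm_mdeg // lem_subr.
rewrite (bigD1 (BMultinom lt_m)) ?lem_subr //= mcoeffZ mcoeffX subKm // eqxx.
rewrite mulr1 big1 ?addr0 // => k /andP[le_k ne_k].
rewrite mcoeffZ mcoeffX; case: eqP => [e|]; rewrite ?mulr0 //.
by case/eqP: ne_k; apply/val_inj; rewrite /= -e subKm.
Qed.

Definition bounded f := forall m, ~~ (m <= delta)%MM -> f@_m = 0.

Lemma bounded_crem f : bounded (crem f).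
Proof. by move=> m nle_m; rewrite mcoeff_crem (negPf nle_m). Qed.

(** The map m |-> delta - m is an involution on the divisors of x^delta. *)
Lemma cremK f : bounded f -> crem (crem f) = f.
Proof.
move=> bf; apply/mpolyP => m; rewrite mcoeff_crem.
by case: ifPn => [le_m|/bf //]; rewrite mcoeff_crem lem_subr subKm.
Qed.

Lemma crem_homog d f : f \is d.-homog -> crem f \is (mdeg delta - d).-homog.
Proof.
move=> fh; apply/dhomogP => m; rewrite mcoeff_msupp mcoeff_crem.
case: ifP => [le_m|]; rewrite ?eqxx // -mcoeff_msupp => /(dhomog_mf fh) /= <-.
by rewrite -mdeg_subm ?lem_subr // subKm.
Qed.

Lemma boundedE f : bounded f ->
  f = \sum_(m : 'X_{1..n < (mdeg delta).+1} | (m <= delta)%MM) f@_m *: 'X_[m].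
Proof.
move=> bf; apply/mpolyP => m; rewrite raddf_sum /=.
have [le_m|nle_m] := boolP (m <= delta)%MM; last first.
  rewrite bf // big1 // => k le_k; rewrite mcoeffZ mcoeffX.
  by case: eqP nle_m => [<-|]; rewrite ?le_k ?mulr0.
have lt_m : (mdeg m < (mdeg delta).+1)%N by rewrite ltnS lepm_mdeg.
rewrite (bigD1 (BMultinom lt_m)) //= mcoeffZ mcoeffX eqxx mulr1.
rewrite big1 ?addr0 // => k /andP[le_k ne_k].
rewrite mcoeffZ mcoeffX; case: eqP => [e|]; rewrite ?mulr0 //.
by case/eqP: ne_k; apply/val_inj.
Qed.

Lemma bounded_big_degree d f :
  bounded f -> f \is d.-homog -> (mdeg delta < d)%N -> f = 0.
Proof.
move=> bf fh lt_d; apply/mpolyP => m; rewrite mcoeff0.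
have [le_m|/bf //] := boolP (m <= delta)%MM.
apply: (dhomog_nemf_coeff fh); rewrite neq_ltn.
by rewrite (leq_ltn_trans (lepm_mdeg le_m)).
Qed.

(** This is the identity for L^delta f(1/L) with denominators cleared: if P is the product of the
    [L i], then P / [L i] is the product of the other factors and f(P/L) = P^d f(1/L). *)
Lemma mmap_crem (S : comNzRingType) (a : {rmorphism K -> S}) (L : 'I_n -> S)
    (d : nat) (f : {mpoly K[n]}) :
    bounded f -> f \is d.-homog ->
  mmap a L (crem f) * (\prod_i L i) ^+ d =
  mmap1 L delta * mmap a (fun i => \prod_(j | j != i) L j) f.
Proof.
move=> bf fh; rewrite {2}(boundedE bf) /crem !raddf_sum /= mulr_suml mulr_sumr.
apply: eq_bigr => m le_m; rewrite !mmapZ !mmapX.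
(* A monomial with nonzero coefficient has degree exactly d, so P^d can be distributed over its
   factors. *)
have [->|nz] := eqVneq f@_m 0; first by rewrite rmorph0 !mul0r mulr0.
rewrite mulrCA -mulrA; congr (_ * _).
have /= <- : mdeg m = d by apply: (dhomog_mf fh); rewrite mcoeff_msupp.
rewrite -[in mmap1 L delta](submK le_m) commr_mmap1_M => [|i x]; last exact: mulrC.
rewrite -mulrA; congr (_ * _).
rewrite /mmap1 -big_split /= mdegE expr_sum; apply: eq_bigr => i _.
by rewrite (bigD1 i) //= exprMn.
Qed.

End Cremona.

Lemma mmap_scale_homog (K : nzRingType) (n d : nat) (S : comNzRingType)
    (a : {rmorphism K -> S}) (h : 'I_n -> S) (t : S) (f : {mpoly K[n]}) :
  f \is d.-homog -> mmap a (fun i => t * h i) f = t ^+ d * mmap a h f.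
Proof.
move=> /dhomog_mf fh; rewrite /mmap mulr_sumr big_seq [RHS]big_seq.
apply: eq_bigr => m /fh /= <-; rewrite mulrCA; congr (_ * _).
rewrite /mmap1 mdegE expr_sum -big_split /=.
by apply: eq_bigr => i _; rewrite exprMn.
Qed.

Lemma mmap_eq (R S : nzRingType) (n : nat) (a : R -> S) (h1 h2 : 'I_n -> S)
    (f : {mpoly R[n]}) :
  h1 =1 h2 -> mmap a h1 f = mmap a h2 f.
Proof.
by move=> e; apply: eq_bigr => m _; rewrite (mmap1_eq m e).
Qed.

(** Along L = y + tq the degree in t of L^delta f(1/L) is |delta| plus that of f(1/L). For large t,
    1/L is p/t up to order 1/t^2, so the Taylor term of order k of f contributes degree at most -2(d
    - k) - k = k - 2d, with k < [size (taylor p f)]. The proof works with denominators cleared. *)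
Lemma size_taylor_crem (K : fieldType) (n d : nat) (delta : 'X_{1..n.+1})
    (p q : 'I_n.+1 -> K) (f : {mpoly K[n.+1]}) :
    [pchar K] =i pred0 -> (forall i, p i * q i = 1) ->
    bounded delta f -> f \is d.-homog -> f != 0 ->
  (size (taylor q (crem delta f)) + d.*2 <= mdeg delta + size (taylor p f))%N.
Proof.
move=> char0 pq1 bf fh nz_f.
pose R := {mpoly K[n.+1]}.
pose a : {rmorphism K -> {poly R}} := (@polyC R \o @mpolyC n.+1 K).
pose L i : {poly R} := ('X_i)%:P + a (q i) * 'X.
pose P := \prod_i L i.
pose M i := \prod_(j | j != i) L j.
(* [w i] is what remains of t [M i] after removing [p i] P; its degree in t drops to n. *)
pose w i := - (a (p i) * ('X_i)%:P) * M i.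
have nz_q i : (q i)%:MP_[n.+1] != 0.
  rewrite mpolyC_eq0; apply: contra_eq_neq (pq1 i) => ->.
  by rewrite mulr0 eq_sym oner_eq0.
have sL i : size (L i) = 2%N.
  by rewrite /L addrC size_MXaddC polyC_eq0 (negPf (nz_q i)) size_polyC nz_q.
have nzL i : L i != 0 by rewrite -size_poly_gt0 sL.
have nzP : P != 0 by apply/prodf_neq0.
have sP : size P = n.+2.
  rewrite size_prod // (eq_bigr (fun=> 2%N)) // sum_nat_const card_ord.
  by rewrite mulnC mul2n -addnn -addSn addnK.
have sM i : (size (M i) <= n.+1)%N.
  have := size_mul (nzL i) (_ : M i != 0); rewrite -/(M i).
  have nzM : M i != 0 by apply/prodf_neq0.
  move=> /(_ nzM); have <- : P = L i * M i by rewrite /P (bigD1 i).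
  by rewrite sP sL add2n => -[<-].
have sw i : (size (w i) <= n.+1)%N.
  apply: (@size_mul_le _ _ _ 0) => //.
  rewrite size_polyN /a /= -polyCM; exact: size_polyC_leq1.
(* [1/L_i = p_i/t - y_i p_i/(t L_i)] multiplied by [t P], where [P = \prod_i L_i]. *)
have EM i : 'X * M i = w i + a (p i) * P.
  rewrite /P (bigD1 i) //= -/(M i) /w /L.
  rewrite mulrDl mulrDr mulNr !mulrA addrA addNr add0r.
  by rewrite -(rmorphM a) pq1 rmorph1 mul1r.
(* By homogeneity t^d f(M) = f(tM) = f(w + pP), which is expanded with increment P. *)
have F1 : 'X^d * mmap a M f =
    \sum_(k < size (taylor p f)) mmap a w (taylor p f)`_k * P ^+ k.
  rewrite -mmap_taylor -mmap_scale_homog //; exact: mmap_eq.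
have F2 : taylor q (crem delta f) * P ^+ d = mmap1 L delta * mmap a M f.
  by rewrite taylorE; apply: mmap_crem.
have nz_G : taylor q (crem delta f) != 0.
  by apply: taylor_neq0; apply: contra_neq nz_f => c0; rewrite -(cremK bf) c0 linear0.
have nz_Ld : mmap1 L delta != 0 by apply/prodf_neq0 => i _; rewrite expf_neq0.
have s_Ld : size (mmap1 L delta) = (mdeg delta).+1.
  rewrite size_prod => [|i _]; last by rewrite expf_neq0.
  rewrite (eq_bigr (fun i => (delta i + 1)%N)) => [|i _]; last first.
    rewrite -[LHS]prednK ?size_exp ?sL ?mul1n ?addn1 //.
    by rewrite size_poly_gt0 expf_neq0.
  by rewrite big_split /= sum_nat_const card_ord muln1 -mdegE -addSn addnK.
have s_Pd : size (P ^+ d) = (n.+1 * d).+1.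
  by rewrite -[LHS]prednK ?size_exp ?sP // size_poly_gt0 expf_neq0.
have nz_F : mmap a M f != 0.
  have : taylor q (crem delta f) * P ^+ d != 0 by rewrite mulf_neq0 // expf_neq0.
  by rewrite F2 mulf_eq0 negb_or => /andP[].
have sF : (size (mmap a M f) + d <= n * d + size (taylor p f))%N.
  rewrite addnC -size_mulXn // mulrC F1 -[X in (_ <= _ + X)%N]prednK; last first.
    by rewrite size_poly_gt0 taylor_neq0.
  rewrite addnS.
  apply: (big_ind (fun u : {poly R} => size u <= (n * d + (size (taylor p f)).-1).+1)%N).
  - by rewrite size_poly0.
  - by move=> u v su sv; apply: leq_trans (size_polyD _ _) _; rewrite geq_max su.
  move=> k _.
  have le_kd : (k <= d)%N by rewrite -ltnS (leq_trans (ltn_ord k)) // size_taylor_homog.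
  (* The term of order k has degree at most n(d - k) + (n + 1)k = nd + k. *)
  apply: (@leq_trans (n * (d - k) + n.+1 * k).+1); last first.
    rewrite ltnS mulSn addnCA -mulnDr subnK // addnC leq_add2l -ltnS prednK //.
    exact: leq_ltn_trans (ltn_ord k).
  apply: size_mul_le; last by apply: size_exp_bound; rewrite sP.
  by apply: size_mmap_homog => //; apply: coef_taylor_homog.
(* Degrees add exactly in [F2], because the coefficient ring is a domain. *)
have eq_size : (size (taylor q (crem delta f)) + n.+1 * d =
                mdeg delta + size (mmap a M f))%N.
  have := congr1 (fun u : {poly R} => size u) F2.
  by rewrite !size_mul ?expf_neq0 // s_Ld s_Pd addnS addSn.
move: eq_size sF; rewrite mulSn.
set G := size (polyseq (taylor q _)); set e := size (polyseq (taylor p f)).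
set F := size (polyseq (mmap a M f)).
move: G e F (n * d)%N (mdeg delta) => G e F nd s; lia.
Qed.

(** * Apolarity and inverse systems *)

Lemma dim_quot_pieceE (K : fieldType) (n r d : nat) (g : 'I_r -> {mpoly K[n.+1]}) :
  dim_quot_piece g d = (\dim {:dhomog n.+1 K d} - \dim (ideal_piece g d))%N.
Proof. exact: dim_quotvs. Qed.

Section Annihilator.
Variables (K : fieldType) (V : vectType K) (B : V -> V -> K).
Hypothesis BlinL : forall v, scalar (B^~ v).
Hypothesis BlinR : forall u, scalar (B u).
Hypothesis Bnondeg : forall v, (forall u, B u v = 0) -> v = 0.

Let ev m (b : m.-tuple V) (v : V) : 'rV[K]_m := \row_i B (tnth b i) v.

Let ev_is_linear m (b : m.-tuple V) : linear (ev b).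
Proof. by move=> a u v; apply/rowP => i; rewrite !mxE BlinR. Qed.

Let ker_ev m (b : m.-tuple V) (f : 'Hom(V, 'rV[K]_m)) (U : {vspace V}) v :
    f =1 ev b -> basis_of U b ->
  v \in lker f -> forall u, u \in U -> B u v = 0.
Proof.
move=> fE bU; rewrite memv_ker fE => /eqP/rowP ev0 u uU.
pose Bv := GRing.isLinear.Build K V K^o _ (B^~ v) (BlinL v).
pose F : {linear V -> K^o} := HB.pack (B^~ v) Bv.
rewrite -[B u v]/(F u) (coord_basis bU uU) linear_sum big1 // => i _.
by rewrite linearZ /= -tnth_nth; have := ev0 i; rewrite !mxE => ->; rewrite scaler0.
Qed.

Let evH m (b : m.-tuple V) : {f : 'Hom(V, 'rV[K]_m) | f =1 ev b}.
Proof.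
pose mx := GRing.isLinear.Build K V 'rV[K]_m _ (ev b) (ev_is_linear b).
pose F : {linear V -> 'rV[K]_m} := HB.pack (ev b) mx.
by exists (linfun F) => v; rewrite lfunE.
Qed.

(** Upper bound: a vector of W killed by a complement of U is killed by everything, so evaluation on
    a basis of the complement is injective on W. Lower bound: rank-nullity for evaluation on a basis
    of U. *)
Lemma dim_annihilator (U W : {vspace V}) :
    (forall v, v \in W <-> forall u, u \in U -> B u v = 0) ->
  \dim W = (\dim {:V} - \dim U)%N.
Proof.
move=> WP; apply/eqP; rewrite eqn_leq; apply/andP; split.
  rewrite -dimv_compl; have [f fE] := evH (vbasis U^C).
  rewrite -(limg_dim_eq (f := f)).
    by rewrite (leq_trans (dimvS (subvf _))) // dimvf dim_matrix mul1r.
  apply/eqP; rewrite -subv0; apply/subvP => v; rewrite memv_cap memv0.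
  move=> /andP[/WP vU /(ker_ev fE (vbasisP _)) vC]; apply/eqP/Bnondeg => u.
  have : u \in (U + U^C)%VS by rewrite addv_complf memvf.
  case/memv_addP => u1 u1U [u2 u2C ->].
  by rewrite -[u1]scale1r BlinL vU // vC // mulr0 addr0.
have [f fE] := evH (vbasis U).
rewrite leq_subLR -[leqLHS](limg_ker_dim f) addnC leq_add //; last first.
  by apply/dimvS/subvP => v; rewrite memv_cap memvf => /(ker_ev fE (vbasisP _))/WP.
by rewrite (leq_trans (dimvS (subvf _))) // dimvf dim_matrix mul1r.
Qed.

End Annihilator.

Section Apolarity.
Variables (K : fieldType) (n : nat).
Implicit Types f g h : {mpoly K[n]}.

Definition mfact (m : 'X_{1..n}) : nat := \prod_i (m i)`!.

Lemma mfactU m i : mfact (m + U_(i)) = (mfact m * (m i).+1)%N.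
Proof.
rewrite /mfact (bigD1 i) //= [in RHS](bigD1 i) //= mnmDE mnm1E eqxx addn1 factS.
rewrite -mulnA mulnC; congr (_ * _ * _)%N.
apply: eq_bigr => j ji.
by rewrite mnmDE mnm1E eq_sym (negPf ji) addn0.
Qed.

Lemma mfact_gt0 m : (0 < mfact m)%N.
Proof. by apply: prodn_gt0 => i; apply: fact_gt0. Qed.

(** The constant term of f(∂)g: the weights m! make multiplication by a variable adjoint to the
    partial derivative. *)
Definition apol f g : K :=
  \sum_(m <- msupp f) f@_m * (g@_m * (mfact m)%:R).

Lemma apolwE k f g : (msize f <= k)%N ->
  apol f g = \sum_(m : 'X_{1..n < k}) f@_m * (g@_m * (mfact m)%:R).
Proof.
move=> le_fk; pose I : subFinType _ := 'X_{1..n < k}.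
rewrite /apol (big_mksub I) ?msupp_uniq //=; first last.
  by move=> x /msize_mdeg_lt /leq_trans; apply.
rewrite big_rmcond //= => j /memN_msupp_eq0 ->.
by rewrite mul0r.
Qed.

Lemma apolC f g : apol f g = apol g f.
Proof.
rewrite !(@apolwE (maxn (msize f) (msize g))) ?leq_maxl ?leq_maxr //.
by apply: eq_bigr => m _; rewrite mulrCA.
Qed.

Lemma apol_linr f : scalar (apol f).
Proof.
move=> a g h; rewrite /apol mulr_sumr -big_split; apply: eq_bigr => m _ /=.
by rewrite mcoeffD mcoeffZ mulrDl mulrDr -mulrA mulrCA.
Qed.

Lemma apol_linl g : scalar (apol^~ g).
Proof. by move=> a f h; rewrite !(apolC _ g) apol_linr. Qed.

HB.instance Definition _ f :=
  GRing.isLinear.Build K {mpoly K[n]} K *%R (apol f) (apol_linr f).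

Lemma apolX m g : apol 'X_[m] g = g@_m * (mfact m)%:R.
Proof. by rewrite /apol msuppX big_seq1 mcoeffX eqxx mul1r. Qed.

Lemma apol_eq0P g : [pchar K] =i pred0 ->
  (forall m, apol 'X_[m] g = 0) -> g = 0.
Proof.
move=> /pcharf0P char0 g0; apply/mpolyP => m; rewrite mcoeff0.
have /eqP := g0 m; rewrite apolX mulf_eq0 char0.
by rewrite (gtn_eqF (mfact_gt0 m)) orbF => /eqP.
Qed.

Lemma apolMX i f g : apol ('X_i * f) g = apol f g^`M(i).
Proof.
rewrite [LHS]apolC [RHS]apolC [f]mpolyE mulr_sumr !linear_sum; apply: eq_bigr => m _.
rewrite -scalerAr !linearZ; congr (_ * _) => /=.
rewrite [LHS]apolC [RHS]apolC -mpolyXD addmC !apolX mcoeff_mderiv mfactU.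
by rewrite mulrnAl -mulrnAr natrM mulr_natr.
Qed.

Definition lform (p : 'I_n -> K) : {mpoly K[n]} := \sum_i p i *: 'X_i.

Lemma apol_lform p f g : apol (lform p * f) g = apol f (dird p g).
Proof.
rewrite apolC /lform mulr_suml /dird !linear_sum; apply: eq_bigr => i _ /=.
by rewrite -scalerAl !linearZ /= apolC apolMX.
Qed.

Lemma apol_lformX p k f g :
  apol (f * lform p ^+ k) g = apol f (iter k (dird p) g).
Proof.
rewrite mulrC; elim: k g => [|k IHk] g; first by rewrite expr0 mul1r.
by rewrite exprS -mulrA apol_lform IHk -iterSr.
Qed.

End Apolarity.

Lemma dhomog1_lform (K : fieldType) (n : nat) (l : dhomog n.+1 K 1) :
  mpoly_of_dhomog l = lform (fun i => (mpoly_of_dhomog l)@_(U_(i))).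
Proof.
apply/mpolyP => m; rewrite /lform raddf_sum /=.
have [/mdeg1P[i /eqP ->]|m1] := boolP (mdeg m == 1%N).
  rewrite (bigD1 i) //= mcoeffZ mcoeffX eqxx mulr1 big1 ?addr0 // => j ji.
  by rewrite mcoeffZ mcoeffXU (negPf ji) mulr0.
rewrite (dhomog_nemf_coeff (dhomog_is_dhomog l)) // big1 // => j _.
rewrite mcoeffZ mcoeffX; case: eqP => [e|]; last by rewrite mulr0.
by rewrite -e mdeg1 eqxx in m1.
Qed.

Section PerpIdeal.
Variables (K : fieldType) (n r d : nat).
Hypothesis char0 : [pchar K] =i pred0.
Variables (l : 'I_r -> dhomog n.+1 K 1) (e : 'I_r -> nat).

Definition coefl i j : K := (mpoly_of_dhomog (l i))@_(U_(j)).

Definition inverse_system (f : dhomog n.+1 K d) : Prop :=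
  forall i, iter (e i) (dird (coefl i)) (mpoly_of_dhomog f) = 0.

(** Powers of [l i] pass across the pairing as derivatives. Conversely, the derivative of f is
    tested against all monomials. *)
Lemma inverse_systemP f : inverse_system f <->
  forall u, u \in ideal_piece (power_forms l e) d ->
    apol (mpoly_of_dhomog u) (mpoly_of_dhomog f) = 0.
Proof.
split=> [If u /mem_ideal_piece[c ->]|perp i].
  rewrite apolC linear_sum big1 // => i _ /=.
  by rewrite apolC /power_forms dhomog1_lform apol_lformX If linear0.
apply: (apol_eq0P char0) => m; rewrite -apol_lformX -dhomog1_lform.
set u := 'X_[m] * _.
have uh : u \is (mdeg m + 1 * e i).-homog.
  by apply: dhomogM; [rewrite dhomogX|apply: dhomogMn; apply: dhomog_is_dhomog].
(* In degree d the product lies in the ideal piece; in any other degree it is orthogonal to f. *)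
have [ed|ne_d] := eqVneq (mdeg m + 1 * e i)%N d.
  rewrite ed in uh; apply: (perp (DHomog uh)); apply/mem_ideal_piece.
  exists (fun j => if j == i then 'X_[m] else 0).
  rewrite (bigD1 i) //= eqxx big1 ?addr0 // => j /negPf ->.
  by rewrite mul0r.
rewrite /apol big_seq big1 // => k /(dhomog_mf uh) /= dk.
rewrite (dhomog_nemf_coeff (dhomog_is_dhomog f)) /= ?dk //.
by rewrite mul0r mulr0.
Qed.

Lemma dim_inverse_system : exists2 W : {vspace dhomog n.+1 K d},
    forall f, f \in W <-> inverse_system f &
    dim_quot_piece (power_forms l e) d = \dim W.
Proof.
have [|a u v Iu Iv i|W WP] := @vspace_of_prop K _ inverse_system.
- by move=> i; rewrite linear0; elim: (e i) => //= k ->; rewrite linear0.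
- rewrite linearP /=.
  have iterP k x y : iter k (dird (coefl i)) (a *: x + y) =
      a *: iter k (dird (coefl i)) x + iter k (dird (coefl i)) y.
    by elim: k => //= k ->; rewrite linearP.
  by rewrite iterP Iu Iv scaler0 addr0.
exists W => //; rewrite dim_quot_pieceE.
pose B (u v : dhomog n.+1 K d) := apol (mpoly_of_dhomog u) (mpoly_of_dhomog v).
rewrite -(@dim_annihilator _ _ B _ _ _ (ideal_piece (power_forms l e) d) W) //.
- by move=> v a u1 u2; rewrite /B linearP apol_linl.
- by move=> u a v1 v2; rewrite /B !linearP.
- move=> v v0; apply: val_inj => /=.
  apply: (apol_eq0P char0) => m.
  have [md|ne_d] := eqVneq (mdeg m) d.
    have Xh : ('X_[m] : {mpoly K[n.+1]}) \is d.-homog by rewrite dhomogX /= md.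
    exact: (v0 (DHomog Xh)).
  by rewrite apolX (dhomog_nemf_coeff (dhomog_is_dhomog v)) ?mul0r.
- by move=> f; rewrite WP inverse_systemP.
Qed.

End PerpIdeal.

Lemma dird_delta (K : fieldType) (n : nat) (i : 'I_n) (f : {mpoly K[n]}) :
  dird (fun j => (i == j)%:R) f = f^`M(i).
Proof.
rewrite /dird (bigD1 i) //= eqxx scale1r big1 ?addr0 // => j /negPf ji.
by rewrite eq_sym ji scale0r.
Qed.

Lemma dird_eq (K : fieldType) (n : nat) (p q : 'I_n -> K) :
  p =1 q -> dird p =1 dird q.
Proof. by move=> pq f; apply: eq_bigr => i _; rewrite pq. Qed.

Lemma boundedP (K : fieldType) (n : nat) (delta : 'X_{1..n}) (f : {mpoly K[n]}) :
  [pchar K] =i pred0 ->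
  bounded delta f <-> forall i, iter (delta i).+1 (mderiv i) f = 0.
Proof.
move=> char0; split=> [bf i|df0 m].
  rewrite -mderivn_iter; apply/mpolyP => m; rewrite mcoeff0 mcoeff_mderivm.
  rewrite bf ?mul0rn //; apply/mnm_lepP => /(_ i).
  by rewrite mnmDE mulmnE mnm1E eqxx mul1n addnC addnS ltnNge leq_addl.
rewrite negb_forall => /existsP[i]; rewrite -ltnNge => lt_i.
(* This coefficient of the derivative is a positive integer multiple of [f@_m]. *)
have := congr1 (mcoeff (m - U_(i) *+ (delta i).+1)%MM) (df0 i).
have le_m : (U_(i) *+ (delta i).+1 <= m)%MM.
  by apply/mnm_lepP => j; rewrite mulmnE mnm1E; case: eqP => [<-|]; rewrite ?mul1n.
rewrite -mderivn_iter mcoeff0 mcoeff_mderivm addmC (submK le_m).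
apply: (@char0_mulrn_eq0 K K^o) => //; apply: prodn_gt0 => j.
by rewrite ffact_gt0; apply/mnm_lepP: j.
Qed.

(** * The Cremona correspondence for normalized families *)

Section NormalizedForms.
Variables (K : fieldType) (n r : nat) (le_n_r : (n.+1 <= r)%N).
Hypothesis char0 : [pchar K] =i pred0.

(** Nonzero coefficients make the reciprocal direction of each remaining form available. *)
Definition normalized (l : 'I_r -> dhomog n.+1 K 1) : Prop :=
  (forall (i : 'I_n.+1) j, coefl l (widen_ord le_n_r i) j = (i == j)%:R) /\
  (forall (i : 'I_r) j, (n.+1 <= i)%N -> coefl l i j != 0).

Variables (ds : 'I_r -> nat).
Hypothesis ds_gt0 : forall i, (0 < ds i)%N.

(** Its degree is k + 2d in the notation of the theorem: [mdeg corner - d] stands for d + k, and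
    [mdeg corner + ds j] is compared with 2d where the theorem compares d_j + k with 0. *)
Definition corner : 'X_{1..n.+1} :=
  [multinom (ds (widen_ord le_n_r i)).-1 | i < n.+1].

Lemma inverse_system_bounded d (l : 'I_r -> dhomog n.+1 K 1)
    (f : dhomog n.+1 K d) :
  normalized l ->
  inverse_system l ds f <->
  bounded corner (mpoly_of_dhomog f) /\
  forall i : 'I_r, (n.+1 <= i)%N ->
    iter (ds i) (dird (coefl l i)) (mpoly_of_dhomog f) = 0.
Proof.
move=> [l_top _].
have E i k (g : {mpoly K[n.+1]}) :
    iter k (dird (coefl l (widen_ord le_n_r i))) g = iter k (mderiv i) g.
  elim: k => //= k ->; rewrite -dird_delta; exact: dird_eq.
split=> [If|[/(boundedP _ _ char0) bf If] i].
  split=> [|i _]; last exact: If.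
  apply/boundedP => // i; rewrite mnmE prednK // -E; exact: If.
have [/If //|lt_i] := leqP n.+1 i.
have -> : i = widen_ord le_n_r (Ordinal lt_i) by apply: val_inj.
by have := bf (Ordinal lt_i); rewrite mnmE prednK // -E.
Qed.

(** In the first case [size_taylor_crem] leaves size 0 for the Taylor polynomial of the Cremona
    image of a nonzero f, which is impossible; in the second no divisor of x^delta has degree d. *)
Lemma normalized_dim_eq0 d (l : 'I_r -> dhomog n.+1 K 1) :
    normalized l ->
    (exists2 j : 'I_r, (n.+1 <= j)%N & (mdeg corner + ds j <= d.*2)%N) \/
      (mdeg corner < d)%N ->
  dim_quot_piece (power_forms l ds) d = 0%N.
Proof.
move=> nl van; have [W WP ->] := @dim_inverse_system K n r d char0 l ds.
suff -> : W = 0%VS by rewrite dimv0.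
apply/eqP; rewrite -subv0; apply/subvP => f /WP /(inverse_system_bounded _ nl).
move=> [bf If]; rewrite memv0; apply/eqP/val_inj => /=.
case: van => [[j le_nj le_j]|]; last exact: bounded_big_degree bf (dhomog_is_dhomog f).
apply/eqP/contraT => nz_f.
have pq1 i : coefl l j i * (coefl l j i)^-1 = 1 by rewrite mulfV // nl.2.
have := size_taylor_crem char0 pq1 bf (dhomog_is_dhomog f) nz_f.
have /(size_taylorP _ char0) := If j le_nj.
have : (0 < size (taylor (fun i => (coefl l j i)^-1) (crem corner f)))%N.
  rewrite size_poly_gt0 taylor_neq0 //; apply: contraNneq nz_f => c0.
  by rewrite -(cremK bf) c0 linear0.
move: le_j; set e := size (polyseq (taylor _ f)).
set G := size (polyseq _); move: e G (mdeg corner) => e G s; lia.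
Qed.

Definition crem_dhomog d (f : dhomog n.+1 K d) :
    dhomog n.+1 K (mdeg corner - d) :=
  DHomog (crem_homog corner (dhomog_is_dhomog f)).

Lemma crem_dhomog_is_linear d : linear (@crem_dhomog d).
Proof. by move=> a f g; apply: val_inj; rewrite /= linearP. Qed.
HB.instance Definition _ d := GRing.isLinear.Build K (dhomog n.+1 K d)
  (dhomog n.+1 K (mdeg corner - d)) _ (@crem_dhomog d) (@crem_dhomog_is_linear d).

End NormalizedForms.

(** The Cremona map is injective on the first inverse system and, by [size_taylor_crem], lands in
    the second. *)
Lemma dim_le_cremona (K : fieldType) (n r : nat) (le_n_r : (n.+1 <= r)%N)
    (ds ds' : 'I_r -> nat) (l l' : 'I_r -> dhomog n.+1 K 1) (d : nat) :
    [pchar K] =i pred0 ->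
    (forall i, (0 < ds i)%N) -> (forall i, (0 < ds' i)%N) ->
    (forall i : 'I_r, (i < n.+1)%N -> ds' i = ds i) ->
    (forall j : 'I_r, (n.+1 <= j)%N ->
       (mdeg (corner le_n_r ds) + ds j <= ds' j + d.*2)%N) ->
    normalized le_n_r l -> normalized le_n_r l' ->
    (forall (j : 'I_r) i, (n.+1 <= j)%N -> coefl l j i * coefl l' j i = 1) ->
  (dim_quot_piece (power_forms l ds) d <=
   dim_quot_piece (power_forms l' ds') (mdeg (corner le_n_r ds) - d))%N.
Proof.
move=> char0 ds_gt0 ds'_gt0 ds_top ds_rest nl nl' ll'1.
have eq_corner : corner le_n_r ds' = corner le_n_r ds.
  by apply/mnmP => i; rewrite !mnmE ds_top //= ltn_ord.
have [W WP ->] := @dim_inverse_system K n r d char0 l ds.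
have [W' W'P ->] := @dim_inverse_system K n r (mdeg (corner le_n_r ds) - d) char0 l' ds'.
pose F := linfun (@crem_dhomog K n r le_n_r ds d).
have FE f : F f = @crem_dhomog K n r le_n_r ds d f by rewrite lfunE.
have capW : (W :&: lker F = 0)%VS.
  apply/eqP; rewrite -subv0; apply/subvP => f; rewrite memv_cap memv0 memv_ker FE.
  move=> /andP[/WP/(inverse_system_bounded char0 ds_gt0 _ nl)[bf _]].
  move=> /eqP/(congr1 val) /= c0.
  by apply/eqP/val_inj; rewrite /= -(cremK bf) c0 linear0.
rewrite -(limg_dim_eq capW); apply/dimvS/subvP => _ /memv_imgP[f fW ->].
have [bf If] := (inverse_system_bounded char0 ds_gt0 _ nl).1 ((WP f).1 fW).
apply/W'P/(inverse_system_bounded char0 ds'_gt0 _ nl'); rewrite FE /= eq_corner.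
split=> [|j le_nj]; first exact: bounded_crem.
have [f0|nz_f] := eqVneq (mpoly_of_dhomog f) 0.
  by rewrite f0 linear0; elim: (ds' j) => //= k ->; rewrite linear0.
apply/(size_taylorP _ char0).
have := size_taylor_crem char0 (ll'1 j ^~ le_nj) bf (dhomog_is_dhomog f) nz_f.
have /(size_taylorP _ char0) := If j le_nj.
have := ds_rest j le_nj; set e := size (polyseq (taylor _ f)).
set G := size (polyseq _); move: e G (mdeg _) => e G s; lia.
Qed.

(** * Generic families of linear forms *)

Section LinearChange.
Variables (K : fieldType) (n : nat).
Implicit Types T S : 'M[K]_n.+1.

Lemma lform_homog (p : 'I_n.+1 -> K) : lform p \is 1.-homog.
Proof. by rewrite rpred_sum // => i _; rewrite rpredZ // dhomogX /= mdeg1. Qed.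

Definition dform (p : 'I_n.+1 -> K) : dhomog n.+1 K 1 := DHomog (lform_homog p).

Lemma coefl_dform r (p : 'I_r -> 'I_n.+1 -> K) i j :
  coefl (fun i => dform (p i)) i j = p i j.
Proof.
rewrite /coefl /= /lform raddf_sum (bigD1 j) //= mcoeffZ mcoeffXU eqxx mulr1.
by rewrite big1 ?addr0 // => k /negPf kj; rewrite mcoeffZ mcoeffXU kj mulr0.
Qed.

Definition lsubst T : {mpoly K[n.+1]} -> {mpoly K[n.+1]} :=
  comp_mpoly [tuple lform (T i) | i < n.+1].
HB.instance Definition _ T := GRing.RMorphism.on (lsubst T).
HB.instance Definition _ T := GRing.Linear.on (lsubst T).

Lemma lsubst_lform T (p : 'I_n.+1 -> K) :
  lsubst T (lform p) = lform (fun k => \sum_j p j * T j k).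
Proof.
rewrite /lsubst /lform linear_sum /=.
under eq_bigr do rewrite comp_mpolyZ comp_mpolyXU -tnth_nth tnth_mktuple scaler_sumr.
rewrite exchange_big; apply: eq_bigr => k _; rewrite scaler_suml.
by apply: eq_bigr => j _; rewrite scalerA.
Qed.

Lemma lsubstK T S : T *m S = 1%:M -> cancel (lsubst T) (lsubst S).
Proof.
move=> TS1 f.
apply: (mpoly_morph_ext (a := lsubst S \o lsubst T) (b := idfun)) => [c|i] /=.
  by rewrite /lsubst !comp_mpolyC.
rewrite {2}/lsubst comp_mpolyXU -tnth_nth tnth_mktuple lsubst_lform.
have TS k : \sum_j T i j * S j k = (i == k)%:R.
  by have := congr1 (fun M : 'M_n.+1 => M i k) TS1; rewrite !mxE.
rewrite /lform (bigD1 i) //= [X in _ + X]big1 ?addr0 => [|k /negPf ki].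
  by rewrite TS eqxx scale1r.
by rewrite TS eq_sym ki scale0r.
Qed.

Lemma lsubst_homog T d f : f \is d.-homog -> lsubst T f \is d.-homog.
Proof.
move=> /dhomog_mf fh; rewrite /lsubst comp_mpolyE big_seq rpred_sum // => m /fh /= <-.
rewrite rpredZ // mdegE.
apply: (big_rec2 (fun g k => g \is k.-homog)) => [|i k g _ gh]; first exact: dhomog1.
apply: dhomogM gh; rewrite tnth_mktuple.
by have := dhomogMn (m i) (lform_homog (T i)); rewrite mul1n.
Qed.

(** An invertible substitution embeds the ideal piece of [l] into that of [l']. *)
Lemma dim_quot_lsubst r (l l' : 'I_r -> dhomog n.+1 K 1) (e : 'I_r -> nat) d T S :
    T *m S = 1%:M ->
    (forall i, mpoly_of_dhomog (l' i) = lsubst T (mpoly_of_dhomog (l i))) ->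
  (dim_quot_piece (power_forms l' e) d <= dim_quot_piece (power_forms l e) d)%N.
Proof.
move=> TS1 l'E; rewrite !dim_quot_pieceE; apply: leq_sub2l.
pose F0 (f : dhomog n.+1 K d) : dhomog n.+1 K d :=
  DHomog (lsubst_homog T (dhomog_is_dhomog f)).
have F0lin : linear F0 by move=> a f g; apply: val_inj; rewrite /= !linearP.
pose mx := GRing.isLinear.Build K _ _ _ F0 F0lin.
pose F1 : {linear dhomog n.+1 K d -> dhomog n.+1 K d} := HB.pack F0 mx.
pose F := linfun F1.
have FE f : F f = F0 f by rewrite lfunE.
rewrite -(limg_dim_eq (f := F)).
  apply/dimvS/subvP => _ /memv_imgP[f /mem_ideal_piece[c fE] ->].
  apply/mem_ideal_piece; exists (fun i => lsubst T (c i)); rewrite FE /= fE rmorph_sum.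
  by apply: eq_bigr => i _; rewrite rmorphM /power_forms rmorphXn l'E.
apply/eqP; rewrite -subv0; apply/subvP => f; rewrite memv_cap memv0 memv_ker FE.
move=> /andP[_ /eqP/(congr1 val)/= f0]; apply/eqP/val_inj.
by rewrite /= -(lsubstK TS1 (mpoly_of_dhomog f)) f0 linear0.
Qed.

End LinearChange.

Lemma mcoeff_pihomog (R : nzRingType) (n d : nat) (f : {mpoly R[n]}) m :
  (pihomog mdeg d f)@_m = if mdeg m == d then f@_m else 0.
Proof.
case: ifPn => [/eqP md|ne_d]; last exact: (dhomog_nemf_coeff (pihomogP mdeg d f)).
have /(congr1 (mcoeff m)) := mpolyE f; rewrite raddf_sum /= => ->.
rewrite pihomogE raddf_sum /= big_mkcond; apply: eq_bigr => k _.
rewrite !mcoeffZ mcoeffX; case: (eqVneq k m) => [->|_]; first by rewrite md eqxx.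
by rewrite !mulr0 if_same.
Qed.

(** Only the components of c of degree d - e contribute. Hence the degree d part of an element of an
    ideal with homogeneous generators stays in the ideal. *)
Lemma pihomogM (R : nzRingType) (n d e : nat) (c h : {mpoly R[n]}) :
  h \is e.-homog -> exists c', pihomog mdeg d (c * h) = c' * h.
Proof.
move=> hh; have le_c : (msize c <= msize c)%N by [].
exists (\sum_(k < msize c | (k + e)%N == d) pihomog mdeg k c).
rewrite {1}(pihomog_partitionE (mf := mdeg) le_c) !mulr_suml linear_sum /=.
rewrite [RHS]big_mkcond; apply: eq_bigr => k _.
have ch := dhomogM (pihomogP mdeg k c) hh.
case: ifP => [/eqP <-|/negbT ne_d]; first exact: pihomog_dE.
exact: (pihomog_ne0 ne_d ch).
Qed.

(** * Semicontinuity of the quotient dimension *)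

Section CoefMatrix.
Variables (K : fieldType) (n d m : nat).

(** The ring is arbitrary so that the matrix of a family with indeterminate coefficients can be
    specialized entrywise. *)
Definition coef_mx (R : nzRingType) (w : 'I_m -> {mpoly R[n.+1]}) :
    'M[R]_(m, #|{: 'X_{1..n.+1 < d.+1}}|) :=
  \matrix_(k, j) (w k)@_(enum_val j : 'X_{1..n.+1 < d.+1}).

Lemma free_coef_mx (w : m.-tuple (dhomog n.+1 K d)) :
  free w = row_free (coef_mx (fun k => mpoly_of_dhomog (tnth w k))).
Proof.
have E (v : 'rV[K]_m) :
    (v *m coef_mx (fun k => mpoly_of_dhomog (tnth w k)) = 0) <->
    (\sum_k v 0 k *: tnth w k = 0).
  split=> [/rowP v0|v0].
    apply: val_inj; rewrite /= linear_sum; apply/mpolyP => q; rewrite mcoeff0.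
    have [qd|ne_d] := eqVneq (mdeg q) d; last first.
      rewrite raddf_sum big1 // => k _ /=; rewrite linearZ /=.
      by rewrite (dhomog_nemf_coeff (dhomog_is_dhomog _)) ?mulr0.
    have lt_q : (mdeg q < d.+1)%N by rewrite qd.
    have := v0 (enum_rank (BMultinom lt_q)); rewrite !mxE => e0; rewrite -[RHS]e0.
    rewrite raddf_sum; apply: eq_bigr => k _ /=.
    by rewrite linearZ /= mxE enum_rankK.
  apply/rowP => j; rewrite !mxE.
  have := congr1 (fun f => (mpoly_of_dhomog f)@_(enum_val j : 'X_{1..n.+1 < d.+1})) v0.
  rewrite linear_sum raddf_sum linear0 ?mcoeff0 => e0; rewrite -[RHS]e0.
  by apply: eq_bigr => k _ /=; rewrite linearZ /= mxE.
apply/idP/idP => [/freeP wfree|rf].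
  apply: inj_row_free => v /E v0; apply/rowP => k; rewrite mxE.
  apply: (wfree (fun k => v 0 k)); rewrite -[RHS]v0.
  by apply: eq_bigr => i _; rewrite -tnth_nth.
apply/freeP => c c0 i.
have : (\row_k c k) *m coef_mx (fun k => mpoly_of_dhomog (tnth w k)) = 0.
  apply/E; rewrite -[RHS]c0; apply: eq_bigr => k _.
  by rewrite mxE -tnth_nth.
rewrite -[RHS](mul0mx _ (coef_mx (fun k => mpoly_of_dhomog (tnth w k)))).
by move/(row_free_inj rf)/rowP/(_ i); rewrite !mxE.
Qed.

End CoefMatrix.

Section Semicontinuity.
Variables (K : fieldType) (n r d : nat) (e : 'I_r -> nat).
Implicit Types l : 'I_r -> dhomog n.+1 K 1.

Definition generic_form (i : 'I_r) : {mpoly {mpoly K[r * n.+1]}[n.+1]} :=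
  \sum_j 'X_(mxvec_index i j) *: 'X_j.

Definition coords l : 'I_(r * n.+1) -> K := fun i => coef_forms l 0 i.

Lemma coordsE l i j : coords l (mxvec_index i j) = coefl l i j.
Proof. by rewrite /coords /coef_forms mxvecE mxE. Qed.

Lemma generic_formE l i :
  map_mpoly (meval (coords l)) (generic_form i) = mpoly_of_dhomog (l i).
Proof.
rewrite dhomog1_lform /generic_form /lform rmorph_sum /=; apply: eq_bigr => j _.
rewrite map_mpolyZ map_mpolyX.
by rewrite /= mevalXU coordsE.
Qed.

(* The coefficients c expressing a basis of the ideal piece at l0 are kept fixed
   while the forms vary; F is a minor of the resulting family of vectors. *)
Lemma dim_quot_semicontinuous l0 :
  exists2 F : {mpoly K[r * n.+1]}, F.@[coords l0] != 0 &
    forall l, F.@[coords l] != 0 ->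
      (dim_quot_piece (power_forms l e) d <=
       dim_quot_piece (power_forms l0 e) d)%N.
Proof.
set I0 := ideal_piece (power_forms l0 e) d.
pose b := vbasis I0.
have /fin_all_exists[c cE] (k : 'I_(\dim I0)) : exists c : 'I_r -> {mpoly K[n.+1]},
    mpoly_of_dhomog (tnth b k) = \sum_i c i * power_forms l0 e i.
  by apply/mem_ideal_piece; apply: vbasis_mem; apply: mem_tnth.
pose w l k := \sum_i c k i * power_forms l e i.
pose wgen k := \sum_i map_mpoly (@mpolyC (r * n.+1) K) (c k i) * generic_form i ^+ e i.
(* The coefficients c need not be homogeneous, so away from [l0] the combination must be projected
   to degree d. *)
pose W l k := DHomog (pihomogP mdeg d (w l k)).
pose M l := coef_mx d (fun k => mpoly_of_dhomog (W l k)).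
pose Mgen := coef_mx d (fun k => pihomog mdeg d (wgen k)).
have wgenE l k : map_mpoly (meval (coords l)) (wgen k) = w l k.
  rewrite rmorph_sum; apply: eq_bigr => i _ /=.
  rewrite rmorphM rmorphXn /= generic_formE; congr (_ * _).
  by apply/mpolyP => q; rewrite !mcoeff_map_mpoly /= mevalC.
have ME l : map_mx (meval (coords l)) Mgen = M l.
  apply/matrixP => k j; rewrite !mxE /= !mcoeff_pihomog -wgenE mcoeff_map_mpoly.
  by case: ifP => //=; rewrite raddf0.
have W0 k : W l0 k = tnth b k.
  by apply: val_inj; rewrite /= /w -cE pihomog_dE //; apply: dhomog_is_dhomog.
have [P MP] : exists P, M l0 *m P = 1%:M.
  apply/row_freeP; have := basis_free (vbasisP I0); rewrite -/b free_coef_mx.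
  suff -> : M l0 = coef_mx d (fun k => mpoly_of_dhomog (tnth b k)) by [].
  by apply/matrixP => k j; rewrite !mxE W0.
(* The right inverse P at [l0] is kept constant: F is 1 at [l0], and wherever F is nonzero the rows
   of [M l] stay independent. *)
pose F := \det (Mgen *m map_mx (@mpolyC _ _) P).
have FE l : F.@[coords l] = \det (M l *m P).
  rewrite -det_map_mx map_mxM ME -map_mx_comp; congr (\det (_ *m _)).
  by apply/matrixP => i j; rewrite !mxE /= mevalC.
exists F => [|l]; first by rewrite FE MP det1 oner_neq0.
rewrite FE => nzF; rewrite !dim_quot_pieceE; apply: leq_sub2l.
have freeW : free [tuple W l k | k < \dim I0].
  rewrite free_coef_mx; apply/row_freeP.
  exists (P *m invmx (M l *m P)); rewrite mulmxA -[RHS](@mulmxV _ _ (M l *m P)).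
    by congr (_ *m _ *m _); apply/matrixP => k j; rewrite !mxE tnth_mktuple.
  by rewrite unitmxE unitfE.
move/eqP: freeW; rewrite size_tuple => <-; apply/dimvS/span_subvP => _ /mapP[k _ ->].
have /fin_all_exists[c' c'E] i :
    exists c', pihomog mdeg d (c k i * power_forms l e i) = c' * power_forms l e i.
  exact: pihomogM (dhomogMn (e i) (dhomog_is_dhomog (l i))).
apply/mem_ideal_piece; exists c'; rewrite /= /w linear_sum.
by apply: eq_bigr => i _; apply: c'E.
Qed.

End Semicontinuity.

(** * Generic position and normalization *)

Lemma poly_nonroot (K : fieldType) (p : {poly K}) :
  [pchar K] =i pred0 -> p != 0 -> exists t, p.[t] != 0.
Proof.
(* Characteristic zero makes these [size p] values distinct, one more than p can have as roots. *)
move=> /pcharf0P char0 nz_p; pose rs : seq K := [seq i%:R | i <- iota 0 (size p)].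
have rs_uniq : uniq rs.
  rewrite map_inj_uniq ?iota_uniq // => i j.
  wlog le_ij : i j / (i <= j)%N => [hw e|/eqP].
    by have [|/ltnW] := leqP i j => [/hw|/hw] -> //; exact.
  rewrite eq_sym -subr_eq0 -natrB // char0 subn_eq0 => le_ji.
  by apply/eqP; rewrite eqn_leq le_ij.
have [rs_roots|/allPn[t _ nz_t]] := boolP (all (root p) rs); last by exists t.
by have := max_poly_roots nz_p rs_roots rs_uniq; rewrite size_map size_iota ltnn.
Qed.

(* Restricting to the line through x and y reduces to univariate polynomials. *)
Lemma common_nonzero (K : fieldType) (N : nat) (F G : {mpoly K[N]})
    (x y : 'I_N -> K) :
    [pchar K] =i pred0 -> F.@[x] != 0 -> G.@[y] != 0 ->
  exists z, F.@[z] != 0 /\ G.@[z] != 0.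
Proof.
move=> char0 nzF nzG; pose line t i := x i + (y i - x i) * t.
pose res : {mpoly K[N]} -> {poly K} :=
  mmap (@polyC K) (fun i => (x i)%:P + (y i - x i)%:P * 'X).
have resE t H : (res H).[t] = H.@[line t].
  elim/mpoly_gen_ind: H => [c|i|f g ef eg|f g ef eg].
  - by rewrite /res mmapC hornerC mevalC.
  - by rewrite /res mmapX mmap1U mevalXU !hornerE.
  - by rewrite /res mmapD hornerD ef eg mevalD.
  - by rewrite /res rmorphM hornerM ef eg mevalM.
have [|t] := @poly_nonroot K (res F * res G) char0.
  rewrite mulf_neq0 //.
    apply: contraNneq nzF => F0; have := resE 0 F; rewrite F0 horner0 => ->.
    by apply/eqP/meval_eq => i; rewrite /line mulr0 addr0.
  apply: contraNneq nzG => G0; have := resE 1 G; rewrite G0 horner0 => ->.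
  by apply/eqP/meval_eq => i; rewrite /line mulr1 addrC subrK.
by rewrite hornerM !resE mulf_eq0 negb_or => /andP[]; exists (line t).
Qed.

Section GenericPosition.
Variables (K : fieldType) (n r : nat) (le_n_r : (n.+1 <= r)%N).
Implicit Types l : 'I_r -> dhomog n.+1 K 1.

Definition forms_of (z : 'I_(r * n.+1) -> K) : 'I_r -> dhomog n.+1 K 1 :=
  fun i => dform (fun j => z (mxvec_index i j)).

Lemma coords_forms_of z : coords (forms_of z) =1 z.
Proof. by move=> k; case/mxvec_indexP: k => i j; rewrite coordsE coefl_dform. Qed.

Definition top_mx l : 'M[K]_n.+1 := \matrix_(i, j) coefl l (widen_ord le_n_r i) j.

(** Substituting the inverse of [top_mx l] turns the first n+1 forms into the variables; the other
    coefficients become the adjugate sums divided by the determinant. *)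
Lemma normalize l :
    \det (top_mx l) != 0 ->
    (forall (i : 'I_r) j, (n.+1 <= i)%N ->
       \sum_k coefl l i k * (\adj (top_mx l)) k j != 0) ->
  exists2 l' : 'I_r -> dhomog n.+1 K 1, normalized le_n_r l' & forall e d,
    (dim_quot_piece (power_forms l' e) d <= dim_quot_piece (power_forms l e) d)%N.
Proof.
move=> det_nz adj_nz; set A := top_mx l in det_nz adj_nz.
have A_unit : A \in unitmx by rewrite unitmxE unitfE.
exists (fun i => dform (fun k => \sum_j coefl l i j * (invmx A) j k)).
  split=> [i j|i j le_ni]; rewrite coefl_dform.
    have := congr1 (fun M : 'M[K]_n.+1 => M i j) (mulmxV A_unit); rewrite !mxE => <-.
    by apply: eq_bigr => k _; rewrite mxE.
  rewrite /invmx A_unit.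
  under eq_bigr do rewrite mxE mulrCA; rewrite -mulr_sumr mulf_neq0 ?invr_neq0 //.
  exact: adj_nz.
move=> e d; apply: (dim_quot_lsubst _ _ (mulVmx A_unit)).
by move=> i; rewrite (dhomog1_lform (l i)) lsubst_lform.
Qed.

(* The adjugate replaces the inverse, so that the coefficients of the last forms
   in the coordinates given by the first n+1 become polynomial. *)
Definition position_poly : {mpoly K[r * n.+1]} :=
  let A : 'M_n.+1 := \matrix_(i, j) 'X_(mxvec_index (widen_ord le_n_r i) j) in
  \det A * \prod_(i < r | (n.+1 <= i)%N) \prod_j
    \sum_k 'X_(mxvec_index i k) * (\adj A) k j.

Lemma position_polyE l : position_poly.@[coords l] =
  \det (top_mx l) * \prod_(i < r | (n.+1 <= i)%N) \prod_j
    \sum_k coefl l i k * (\adj (top_mx l)) k j.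
Proof.
rewrite /position_poly; set A := \matrix_(_, _) _.
have AE : map_mx (meval (coords l)) A = top_mx l.
  by apply/matrixP => i j; rewrite !mxE mevalXU coordsE.
rewrite mevalM -det_map_mx AE rmorph_prod; congr (_ * _).
apply: eq_bigr => i _; rewrite rmorph_prod; apply: eq_bigr => j _.
rewrite rmorph_sum; apply: eq_bigr => k _ /=.
by rewrite mevalM mevalXU coordsE -AE -map_mx_adj [in RHS]mxE.
Qed.

Lemma position_poly_neq0 : exists z, position_poly.@[z] != 0.
Proof.
(* The witness consists of the variables followed by copies of their sum. *)
pose l (i : 'I_r) := @dform K n
  (fun j => if (i < n.+1)%N then (i == j :> nat)%:R else 1).
exists (coords l); rewrite position_polyE.
have -> : top_mx l = 1%:M.
  by apply/matrixP => i j; rewrite !mxE coefl_dform /= ltn_ord.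
have -> : \adj (1%:M : 'M[K]_n.+1) = 1%:M.
  by rewrite -[LHS]mul1mx mul_mx_adj det1.
rewrite det1 mul1r; apply/prodf_neq0 => i le_ni; apply/prodf_neq0 => j _.
rewrite (bigD1 j) //= big1 => [|k kj].
  by rewrite coefl_dform ltnNge le_ni mxE eqxx mulr1 addr0 oner_neq0.
by rewrite mxE (negPf kj) mulr0.
Qed.

End GenericPosition.

Lemma exists_minimizer (T : Type) (f : T -> nat) (x0 : T) :
  exists x, forall y, (f x <= f y)%N.
Proof.
have [m] := ubnP (f x0); elim: m x0 => // m IHm x0 lt_x0.
have [[y lt_y]|noy] := classic (exists y, f y < f x0)%N.
  by apply: (IHm y); apply: leq_trans lt_y _.
by exists x0 => y; rewrite leqNgt; apply/negP => lt_y; apply: noy; exists y.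
Qed.

(** * Comparison of minimal dimensions *)

Section GenericForms.
Variables (K : fieldType) (n r : nat) (le_n_r : (n.+1 <= r)%N).
Hypothesis char0 : [pchar K] =i pred0.
Implicit Types (l : 'I_r -> dhomog n.+1 K 1) (F : {mpoly K[r * n.+1]}).

Lemma for_general_formsI F (P : ('I_r -> dhomog n.+1 K 1) -> Prop) :
    (exists z, F.@[z] != 0) -> (forall l, F.@[coords l] != 0 -> P l) ->
  for_general_forms P.
Proof.
move=> [z nz_z] FP; exists (fun x => F.@[fun i => x 0 i] != 0); split=> //.
  exists (eq F) => x; split=> [nz|[_ <-] //]; by exists F.
exists (\row_i z i); rewrite (meval_eq (v2 := z)) // => i.
by rewrite mxE.
Qed.

(** The condition F != 0 holds before normalization; only the dimension bound passes to the
    normalized family. *)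
Lemma exists_normalized F z : F.@[z] != 0 ->
  exists2 l, F.@[coords l] != 0 &
  exists2 l' : 'I_r -> dhomog n.+1 K 1, normalized le_n_r l' & forall e d,
    (dim_quot_piece (power_forms l' e) d <=
                 dim_quot_piece (power_forms l e) d)%N.
Proof.
move=> nzF; have [z1 nz1] := position_poly_neq0 K le_n_r.
have [z2 [nzF2]] := common_nonzero char0 nzF nz1.
rewrite -!(meval_eq _ (coords_forms_of z2)) in nzF2 *.
rewrite position_polyE mulf_eq0 negb_or => /andP[det_nz /prodf_neq0 adj_nz].
exists (forms_of z2) => //; apply: (normalize det_nz) => i j /adj_nz.
by move/prodf_neq0; apply.
Qed.

(** Semicontinuity and normalization replace [l] by a normalized family without raising the
    dimension. Inverting the coefficients of its last forms then permits [dim_le_cremona], applied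
    from ([ds'], [d']) to ([ds], [d]). *)
Lemma exists_cremona_le (ds ds' : 'I_r -> nat) (d d' : nat) l :
    (forall i, (0 < ds i)%N) -> (forall i, (0 < ds' i)%N) ->
    (forall i : 'I_r, (i < n.+1)%N -> ds i = ds' i) ->
    (d + d' = mdeg (corner le_n_r ds'))%N ->
    (forall j : 'I_r, (n.+1 <= j)%N ->
       (mdeg (corner le_n_r ds') + ds' j = ds j + d'.*2)%N) ->
  exists l' : 'I_r -> dhomog n.+1 K 1,
             (dim_quot_piece (power_forms l' ds') d' <=
              dim_quot_piece (power_forms l ds) d)%N.
Proof.
move=> ds_gt0 ds'_gt0 ds_top dd' ds_rest.
have [F nzF Fl] := dim_quot_semicontinuous d ds l.
have [l1 /Fl le_l1 [l2 nl2 le_l2]] := exists_normalized nzF.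
pose l3 (i : 'I_r) := @dform K n
  (fun j => if (i < n.+1)%N then coefl l2 i j else (coefl l2 i j)^-1).
have nl3 : normalized le_n_r l3.
  split=> [i j|i j le_ni]; rewrite coefl_dform /= ?ltn_ord; first exact: nl2.1.
  by rewrite ltnNge le_ni invr_neq0 // nl2.2.
exists l3; apply: leq_trans (leq_trans (le_l2 ds d) le_l1).
have -> : d = (mdeg (corner le_n_r ds') - d')%N by rewrite -dd' addnK.
apply: (dim_le_cremona char0 ds'_gt0 ds_gt0 ds_top _ nl3 nl2) => [j|j i le_nj].
  by move/ds_rest->.
by rewrite coefl_dform ltnNge le_nj mulVf // nl2.2.
Qed.

Lemma general_dim_eq0 (ds : 'I_r -> nat) (d : nat) :
    (forall i, (0 < ds i)%N) ->
    (exists2 j : 'I_r, (n.+1 <= j)%N &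
       (mdeg (corner le_n_r ds) + ds j <= d.*2)%N) \/
    (mdeg (corner le_n_r ds) < d)%N ->
  for_general_forms (fun l => dim_quot_piece (power_forms l ds) d = 0%N).
Proof.
move=> ds_gt0 van.
(* The polynomial 1 imposes no condition: this extracts just a normalized family, from which
   vanishing spreads by semicontinuity. *)
have nz1 : (1 : {mpoly K[r * n.+1]}).@[fun=> 0] != 0 by rewrite meval1 oner_neq0.
have [_ _ [l0 nl0 _]] := exists_normalized nz1.
have l0_0 := normalized_dim_eq0 char0 ds_gt0 nl0 van.
have [F nzF Fl] := dim_quot_semicontinuous d ds l0.
apply: (@for_general_formsI F); first by exists (coords l0).
by move=> l /Fl; rewrite l0_0 leqn0 => /eqP.
Qed.

(** The two minimal dimensions agree by [exists_cremona_le] in both directions, and semicontinuity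
    makes each minimum generic. *)
Lemma general_dim_eq (ds ds' : 'I_r -> nat) (d d' : nat) :
    (forall i, (0 < ds i)%N) -> (forall i, (0 < ds' i)%N) ->
    (forall i : 'I_r, (i < n.+1)%N -> ds' i = ds i) ->
    (d + d' = mdeg (corner le_n_r ds))%N ->
    (forall j : 'I_r, (n.+1 <= j)%N ->
       (ds' j + d.*2 = ds j + mdeg (corner le_n_r ds))%N) ->
  for_general_forms (fun l => dim_quot_piece (power_forms l ds) d =
                              dim_quot_piece (power_forms l ds') d').
Proof.
move=> ds_gt0 ds'_gt0 ds_top dd' ds_rest.
have eq_corner : corner le_n_r ds' = corner le_n_r ds.
  by apply/mnmP => i; rewrite !mnmE ds_top //= ltn_ord.
pose l0 : 'I_r -> dhomog n.+1 K 1 := fun=> 0.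
have [l1 min1] := exists_minimizer (fun l => dim_quot_piece (power_forms l ds) d) l0.
have [l2 min2] := exists_minimizer (fun l => dim_quot_piece (power_forms l ds') d') l0.
have eq12 : dim_quot_piece (power_forms l1 ds) d =
            dim_quot_piece (power_forms l2 ds') d'.
  apply/eqP; rewrite eqn_leq; apply/andP; split.
    have [||l le_l] := @exists_cremona_le ds' ds d' d l2 ds'_gt0 ds_gt0 ds_top.
    - by rewrite addnC.
    - by move=> j /ds_rest ->; rewrite addnC.
    exact: leq_trans (min1 l) le_l.
  have [|||l le_l] := @exists_cremona_le ds ds' d d' l1 ds_gt0 ds'_gt0.
  - by move=> i /ds_top.
  - by rewrite eq_corner.
  - by move=> j /ds_rest; rewrite eq_corner -dd'; lia.
  exact: leq_trans (min2 l) le_l.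
have [F1 nz1 F1l] := dim_quot_semicontinuous d ds l1.
have [F2 nz2 F2l] := dim_quot_semicontinuous d' ds' l2.
apply: (@for_general_formsI (F1 * F2)).
  have [z [nz1z nz2z]] := common_nonzero char0 nz1 nz2.
  by exists z; rewrite mevalM mulf_neq0.
move=> l; rewrite mevalM mulf_eq0 negb_or => /andP[/F1l le1 /F2l le2].
have -> : dim_quot_piece (power_forms l ds) d = dim_quot_piece (power_forms l1 ds) d.
  by apply/anti_leq/andP; split; [exact: le1|exact: min1].
by rewrite eq12; apply/anti_leq/andP; split; [exact: min2|exact: le2].
Qed.

End GenericForms.

Theorem theorem6p3 (K : fieldType) (char0 : [pchar K] =i pred0)
    (n r : nat) (le_n_r : (n.+1 <= r)%N)
    (ds : 'I_r -> nat) (ds_gt0 : forall i, (0 < ds i)%N) (d : nat) :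
  let k : int :=
    \sum_(i < r | (i < n.+1)%N) (ds i)%:Z - (n.+1)%:Z - 2 * d%:Z in
  let ds' (i : 'I_r) : nat :=
    if (i < n.+1)%N then ds i else absz ((ds i)%:Z + k) in
  let vanishing : Prop :=
    (exists2 j : 'I_r, (n.+1 <= j)%N & (ds j)%:Z + k <= 0) \/ d%:Z + k < 0 in
  for_general_forms (fun l : 'I_r -> dhomog n.+1 K 1 =>
    (vanishing -> dim_quot_piece (power_forms l ds) d = 0%N) /\
    (~ vanishing ->
       dim_quot_piece (power_forms l ds) d =
       dim_quot_piece (power_forms l ds') (absz (d%:Z + k)))).
Proof.
move=> k ds' vanishing.
set s := mdeg (corner le_n_r ds).
have kE : k = s%:Z - 2 * d%:Z.
  rewrite /k big_ord_narrow /s mdegE; congr (_ - _).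
  rewrite (eq_bigr (fun i => (corner le_n_r ds i)%:Z + 1)) => [|i _]; last first.
    by rewrite mnmE -[LHS]/(Posz _) -[in LHS](prednK (ds_gt0 _)) -addn1 PoszD.
  rewrite big_split /= sumr_const card_ord natz addrK -natz natr_sum.
  by apply: eq_bigr => i _; rewrite natz.
(* The condition does not involve l, so the case split can precede the choice of the open set. *)
have [van|nvan] := classic vanishing.
  have [|U [Uo Une Ueq]] := @general_dim_eq0 K n r le_n_r char0 ds d ds_gt0.
    case: van => [[j le_nj le_j]|lt_d]; [left; exists j => //|right]; rewrite -/s; lia.
  by exists U; split=> // l /Ueq.
(* Outside the vanishing case d_j + k is positive, so [absz] leaves it unchanged. *)
have ds'_rest (j : 'I_r) : (n.+1 <= j)%N -> (0 < ds' j)%N /\ (ds' j + d.*2 = ds j + s)%N.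
  move=> le_nj; have gt_j : 0 < (ds j)%:Z + k.
    by rewrite ltNge; apply/negP => le_j; apply: nvan; left; exists j.
  by rewrite /ds' [(j < _)%N]ltnNge le_nj /=; lia.
have ge_d : 0 <= d%:Z + k.
  by rewrite leNgt; apply/negP => lt_d; apply: nvan; right.
have [||||U [Uo Une Ueq]] :=
  @general_dim_eq K n r le_n_r char0 ds ds' d (absz (d%:Z + k)) ds_gt0.
- move=> i; have [lt_i|/ds'_rest[]//] := ltnP i n.+1.
  by rewrite /ds' lt_i.
- by move=> i lt_i; rewrite /ds' lt_i.
- by rewrite -/s; lia.
- by move=> j /ds'_rest[].
by exists U; split=> // l /Ueq.
Qed.
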